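(* Let $\Lambda$ be a finite or countable alphabet, $\mu$ a shift-invariant probability measure on $\Lambda^{\mathbb N}$, and $S\subset\mathbb N$ a set of positive lower density. If $\mu$ is disjoint from every measure derived from $S$, then $S$ preserves simple $\mu$-normality: for every $\mu$-normal $x\in\Lambda^{\mathbb N}$ and every $a\in\Lambda$, the symbol $a$ occurs in $x|_S$ with limiting frequency $\mu([a])$.
   Context: $x$ is $\mu$-normal if every finite block $B$ occurs in $x$ with limiting frequency $\mu([B])$. For $S=\{s_1<s_2<\dots\}$, $x|_S=(x_{s_1},x_{s_2},\dots)$. With $y=\mathbbm1_S$, a measure derived from $S$ is a weak-* accumulation point of $\frac1n\sum_{i<n}\delta_{\sigma^iy}$ on $\{0,1\}^{\mathbb N}$ ($\sigma$ the shift). Two invariant measures $\mu,\nu$ are disjoint if the only $\sigma\times\sigma$-invariant measure on the product space with marginals $\mu$ and $\nu$ is $\mu\times\nu$. Lower density $\underline d(S)=\liminf_n\#(S\cap\{1,\dots,n\})/n$. *)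

(* Defs.v *)
From HB Require Import structures.
From mathcomp Require Import all_boot all_order all_algebra.
From mathcomp Require Import all_classical all_reals all_analysis.
Set Implicit Arguments. Unset Strict Implicit. Unset Printing Implicit Defensive.
Import Order.TTheory GRing.Theory Num.Theory.
Import numFieldNormedType.Exports.
Local Open Scope classical_set_scope.
Local Open Scope ring_scope.

Definition blk {A : Type} (x : nat -> A) (k n : nat) : seq A :=
  [seq x (k + i)%N | i <- iota 0 n].

Definition cyl {A : Type} (w : seq A) : set (nat -> A) :=
  [set x | blk x 0 (size w) = w].

Definition cylinders (A : Type) : set (set (nat -> A)) := range (@cyl A).

Definition seqsp (A : pointedType) := g_sigma_algebraType (@cylinders A).

Definition shift {A : Type} (x : nat -> A) : nat -> A := fun n => x n.+1.
Definition shiftn {A : Type} (i : nat) (x : nat -> A) : nat -> A :=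
  fun n => x (n + i)%N.

Definition shift_invariant (R : realType) (A : pointedType)
  (mu : set (seqsp A) -> \bar R) : Prop :=
  forall E : set (seqsp A), measurable E -> mu (shift @^-1` E) = mu E.

Definition occ {A : Type} (x : nat -> A) (w : seq A) (n : nat) : nat :=
  (\sum_(k < n) asbool (blk x k (size w) = w))%N.

Definition normal (R : realType) (A : pointedType)
  (mu : set (seqsp A) -> \bar R) (x : nat -> A) : Prop :=
  forall w : seq A,
    (fun n : nat => (occ x w n)%:R / n%:R : R) @ \oo --> fine (mu (cyl w)).

Definition dens_count (S : set nat) (n : nat) : nat :=
  (\sum_(k < n) asbool (S k))%N.
Definition lower_density (R : realType) (S : set nat) : R :=
  limn_inf (fun n : nat => (dens_count S n)%:R / n%:R : R).

Definition indic_seq (S : set nat) : nat -> bool := fun n => asbool (S n).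

(* nu is a measure derived from S: nu is a weak-* accumulation point of the
   empirical measures (1/n) sum_{i<n} delta_{sigma^i y}, y = 1_S.  A
   weak-* neighbourhood of nu is given by finitely many continuous functions
   f_1..f_m on {0,1}^N and eps > 0. *)
Definition derived_from (R : realType) (S : set nat)
  (nu : set (seqsp bool) -> \bar R) : Prop :=
  forall (m : nat) (f : 'I_m -> cantor_space -> R) (eps : R),
    (forall j, continuous (f j)) -> 0 < eps ->
    forall N : nat, exists2 n : nat, (N <= n)%N /\ (0 < n)%N &
      forall j, (`| (\int[nu]_x (f j x)%:E)%E -
         ((\sum_(i < n) f j (shiftn i (indic_seq S))) / n%:R)%:E | < eps%:E)%E.

Definition joining (R : realType) (A B : pointedType)
  (mu : set (seqsp A) -> \bar R) (nu : set (seqsp B) -> \bar R)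
  (lam : probability (seqsp A * seqsp B)%type R) : Prop :=
  [/\ (forall E : set (seqsp A * seqsp B)%type, measurable E ->
         lam ((fun p : (nat -> A) * (nat -> B) => (shift p.1, shift p.2)) @^-1` E)
         = lam E),
      (forall E : set (seqsp A), measurable E -> lam (fst @^-1` E) = mu E) &
      (forall E : set (seqsp B), measurable E -> lam (snd @^-1` E) = nu E)].

Definition disjoint_measures (R : realType) (A B : pointedType)
  (mu : probability (seqsp A) R) (nu : probability (seqsp B) R) : Prop :=
  forall lam : probability (seqsp A * seqsp B)%type R, joining mu nu lam ->
    forall E : set (seqsp A * seqsp B)%type, measurable E ->
      lam E = (mu \x nu)%E E.

(* e enumerates S in increasing order: e k = s_{k+1} *)
Definition enumerates (S : set nat) (e : nat -> nat) : Prop :=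
  (forall k, (e k < e k.+1)%N) /\ range e = S.

(* Main.v *)
Require Import Defs.
From HB Require Import structures.
From mathcomp Require Import all_boot all_order all_algebra.
From mathcomp Require Import all_classical all_reals all_analysis.
From mathcomp Require Import measurable_realfun ring lra zify.
Import Order.TTheory GRing.Theory Num.Theory.
Import numFieldNormedType.Exports.
Set Implicit Arguments. Unset Strict Implicit. Unset Printing Implicit Defensive.
Local Open Scope classical_set_scope.
Local Open Scope ring_scope.

(** Fix an ultrafilter F on nat containing the cofinite sets. Limits of
    frequencies along F exist for all sets of integers and define a finitely
    additive shift-invariant mean [dens]. Writing y for the indicator sequence
    of S, the block densities of the paired sequence z = (x, y) define a
    shift-invariant probability measure on (L x {0,1})^N: although L may be
    infinite, no mass escapes because the x-marginal is the probability mu.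
    It is a joining of mu with the y-marginal, which is derived from S, so by
    disjointness dens {k in S | x k = a} = mu [a] * dens S. As F is arbitrary,
    this holds in the limit of ordinary frequencies, and the positive lower
    density of S allows one to divide by the frequency of S. *)

(** * Densities along an ultrafilter *)

Lemma dens_count_le (E : set nat) n : (dens_count E n <= n)%N.
Proof.
rewrite /dens_count -[leqRHS]muln1 -[X in (_ <= X * _)%N]card_ord -sum_nat_const.
by apply: leq_sum => i _; case: asbool.
Qed.

Lemma dens_countU (A B : set nat) n : A `&` B = set0 ->
  dens_count (A `|` B) n = (dens_count A n + dens_count B n)%N.
Proof.
move=> AB0; rewrite /dens_count -big_split; apply: eq_bigr => k _ /=.
have := @AB0 : _ => /(congr1 (fun C => C (k : nat))) /= /propeqP [h _].
case: asboolP => [[a|b]|nab]; do 2 case: asboolP => //=; tauto.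
Qed.

Lemma ultra_fmap (T U : Type) (f : T -> U) (F : set_system T) :
  UltraFilter F -> UltraFilter (f @ F).
Proof.
move=> FU; split; first exact: fmap_proper_filter.
move=> G PG FG; apply/seteqP; split => // A GA.
have [//|FA] := in_ultra_setVsetC (f @^-1` A) FU.
have /filter_ex[? []] : G (A `&` ~` A) by apply: filterI => //; exact: FG.
by [].
Qed.

Section Density.
Variables (R : realType) (F : set_system nat).
Context {FU : UltraFilter F}.
Hypothesis Foo : \oo `<=` F.

Definition freq (E : set nat) (n : nat) : R := (dens_count E n)%:R / n%:R.
Definition dens (E : set nat) : R := lim (freq E @ F).

Lemma freq_itv E n : 0 <= freq E n <= 1.
Proof.
(* At [n = 0] the quotient is [0 / 0], which is [0] since [0^-1 = 0]. *)
rewrite /freq divr_ge0//=; case: n => [|n]; first by rewrite invr0 mulr0.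
by rewrite ler_pdivrMr// mul1r ler_nat dens_count_le.
Qed.

(** The image of [F] under [u] is an ultrafilter on the compact segment from [- M] to [M], hence
    converges there. *)
Lemma bounded_ultra_cvg (u : nat -> R) (M : R) :
  (forall n, `|u n| <= M) -> cvg (u @ F).
Proof.
move=> uM.
have := @segment_compact R (- M) M; rewrite compact_ultra => /(_ (u @ F)).
move=> /(_ (ultra_fmap u FU)) [|l [_ ul]]; last by apply/cvg_ex; exists l.
rewrite nbhs_filterE /fmap /= (_ : _ @^-1` _ = setT); first exact: filterT.
by apply/seteqP; split => // n _; rewrite /= in_itv /= -ler_norml.
Qed.

Lemma dens_cvg E : freq E @ F --> dens E.
Proof.
apply: (@bounded_ultra_cvg _ 1) => n.
by have /andP[? ?] := freq_itv E n; rewrite ger0_norm.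
Qed.

Lemma densP E (l : R) : freq E @ F --> l -> dens E = l.
Proof. by move=> h; apply: cvg_lim. Qed.

Lemma dens_normal E (l : R) : freq E @ \oo --> l -> dens E = l.
Proof. by move=> h; apply: densP => A /h; exact: Foo. Qed.

Lemma dens_ge0 E : 0 <= dens E.
Proof.
apply: limr_ge; first exact: dens_cvg.
by apply: nearW => n; have /andP[] := freq_itv E n.
Qed.

Lemma densT : dens setT = 1.
Proof.
apply: dens_normal; apply: cvg_near_cst; exists 1%N => // n /= n0.
rewrite /freq /dens_count (eq_bigr (fun=> 1%N)); last by move=> i _; rewrite asboolT.
rewrite sum_nat_const card_ord muln1 divff// pnatr_eq0 -lt0n//.
Qed.

Lemma densU A B : A `&` B = set0 -> dens (A `|` B) = dens A + dens B.
Proof.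
move=> AB; apply: densP.
rewrite (_ : freq _ = freq A \+ freq B); first by apply: cvgD; exact: dens_cvg.
by apply/funext => n; rewrite /freq dens_countU//= natrD mulrDl.
Qed.

Lemma dens0 : dens set0 = 0.
Proof. by have := @densU set0 set0 (setI0 _); rewrite setU0; lra. Qed.

Lemma densID A B : dens A = dens (A `&` B) + dens (A `&` ~` B).
Proof.
rewrite -densU; first by rewrite -setIUr setUCr setIT.
by rewrite setIACA setICr setI0.
Qed.

Lemma dens_mono A B : A `<=` B -> dens A <= dens B.
Proof.
move=> AB; rewrite [leRHS](densID B A) setIC.
by rewrite (setIidl AB) lerDl dens_ge0.
Qed.

(** The windows [1..n] and [0..n-1] differ only at their end points, so the two frequencies differ
    by at most [1 / n]. *)
Lemma dens_shift E : dens [set k | E k.+1] = dens E.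
Proof.
apply/eqP; rewrite -subr_eq0; apply/eqP.
have h : freq [set k | E k.+1] \- freq E @ F --> dens [set k | E k.+1] - dens E.
  by apply: cvgB; exact: dens_cvg.
apply: (cvg_unique _ h); first exact: Rhausdorff.
apply: (@cvg_trans _ (freq [set k | E k.+1] \- freq E @ \oo)).
  by move=> A; exact: Foo.
apply/cvgrPdist_le => e e0; near=> n.
rewrite sub0r normrN /= /freq -mulrBl normrM.
have -> : (dens_count [set k | E k.+1] n)%:R - (dens_count E n)%:R
   = (asbool (E n))%:R - (asbool (E 0%N))%:R :> R.
  apply/eqP; rewrite subr_eq addrAC -subr_eq opprK -!natrD eqr_nat; apply/eqP.
  rewrite addnC; transitivity (dens_count E n.+1).
    by rewrite /dens_count big_ord_recl.
  by rewrite /dens_count big_ord_recr/= addnC.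
apply: (@le_trans _ _ (1 * `|n%:R^-1|)).
  by rewrite ler_wpM2r//; do 2 case: asbool; rewrite /= ?subrr ?subr0 ?sub0r ?normrN ?normr0 ?normr1.
rewrite mul1r ger0_norm ?invr_ge0//.
rewrite invf_ple ?posrE//; last by rewrite ltr0n; near: n; exists 1%N.
near: n; exists (Num.truncn e^-1).+1 => // m /= hm.
apply: (le_trans (ltW (truncnS_gt _))); by rewrite ler_nat.
Unshelve. all: end_near. Qed.

Lemma dens_shiftn E m : dens [set k | E (k + m)%N] = dens E.
Proof.
elim: m => [|m IH] in E *; first by congr dens; apply/seteqP; split => k /=; rewrite addn0.
rewrite -[RHS]IH -[RHS]dens_shift; congr dens.
by apply/funext => k /=; rewrite addSnnS.
Qed.

End Density.

(** * Blocks and cylinder measurability *)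

Lemma blkS {A : Type} (x : nat -> A) k n : blk x k n.+1 = rcons (blk x k n) (x (k + n)%N).
Proof. by rewrite /blk -[n.+1]addn1 iotaD map_cat cats1. Qed.

Lemma size_blk {A : Type} (x : nat -> A) k n : size (blk x k n) = n.
Proof. by rewrite size_map size_iota. Qed.

Lemma measurable_cyl (A : pointedType) (w : seq A) :
  measurable (cyl w : set (seqsp A)).
Proof. by apply: sub_sigma_algebra; exists w. Qed.

Lemma measurable_fun_seqsp d (T : measurableType d) (A : pointedType)
    (f : T -> seqsp A) :
  (forall w, measurable (f @^-1` cyl w)) -> measurable_fun [set: T] f.
Proof.
move=> mf; apply: (@measurability _ _ T (seqsp A) setT f (@cylinders A)) => //.
by move=> _ [_ [w _ <-] <-]; rewrite setTI.
Qed.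

(** * Measures on sequence spaces with prescribed cylinder probabilities *)

(* The word w gets the half-open interval [I w] of length [p w]; the intervals
   of the words [rcons w c] partition [I w] in the order of [code c]. Reading off
   the words whose intervals contain t sends the uniform law of t in [0, 1[ to the
   required measure. Here [s w n] is the total length of the children of w with
   code less than n. *)
Section SequenceMeasure.
Variables (R : realType) (P : pointedType) (code : P -> nat).
Variables (p : seq P -> R) (s : seq P -> nat -> R).
Hypothesis code_inj : injective code.
Hypothesis p_nil : p [::] = 1.
Hypothesis p_ge0 : forall w, 0 <= p w.
Hypothesis s0 : forall w, s w 0%N = 0.
Hypothesis s_code : forall w c, s w (code c).+1 = s w (code c) + p (rcons w c).
Hypothesis s_notcode : forall w j, (forall c, code c <> j) -> s w j.+1 = s w j.
Hypothesis s_cvg : forall w, s w @ \oo --> p w.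

(** Each prefix of [w] contributes the total length of the siblings that precede the next letter of
    [w]. *)
Let lft w := \sum_(i < size w) s (take i w) (code (nth point w i)).

Let I w : set R := `[lft w, lft w + p w[%classic.

Let lft_rcons w c : lft (rcons w c) = lft w + s w (code c).
Proof.
rewrite /lft size_rcons big_ord_recr/=; congr (_ + _).
  apply: eq_bigr => i _; rewrite nth_rcons ltn_ord -cats1 takel_cat//.
  exact: ltnW.
by rewrite nth_rcons ltnn eqxx -cats1 take_size_cat.
Qed.

Let s_nd w : nondecreasing_seq (s w).
Proof.
apply/nondecreasing_seqP => j.
have [[c <-]|h] := pselect (exists c, code c = j).
  by rewrite s_code lerDl.
by rewrite s_notcode// => c cj; apply: h; exists c.
Qed.

Let s_le w n : s w n <= p w.
Proof.
have cs : cvgn (s w) by apply/cvg_ex; exists (p w).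
have := nondecreasing_cvgn_le (@s_nd w) cs n.
by rewrite (cvg_lim _ (@s_cvg w)).
Qed.

Let s_ge0 w n : 0 <= s w n.
Proof. by rewrite -(s0 w); exact: s_nd. Qed.

Let I_sub w c : I (rcons w c) `<=` I w.
Proof.
move=> t; rewrite /I /= !in_itv/= lft_rcons -addrA -s_code => /andP[a b].
apply/andP; split; first by rewrite (le_trans _ a)// lerDl.
by apply: (lt_le_trans b); rewrite lerD2l.
Qed.

(** Since [s w] tends to [p w], some [s w n] exceeds [t - lft w]. The least such [n] is positive,
    and [s w] jumps just before it, so its predecessor is the code of the child containing [t]. *)
Let I_split w t : I w t -> exists c, I (rcons w c) t.
Proof.
rewrite /I /= in_itv/= => /andP[a b].
have : exists n, t - lft w < s w n.
  have : \forall n \near \oo, t - lft w < s w n.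
    by apply: (cvgr_gt _ (@s_cvg w)); rewrite ltrBlDl.
  by case=> n _ /(_ n (leqnn n)) h; exists n.
move=> /ex_minnP[[|n] hn hmin].
  by move: hn; rewrite s0 subr_lt0 ltNge a.
have hn' : s w n <= t - lft w.
  by rewrite leNgt; apply/negP => /hmin; rewrite ltnn.
have [[c cn]|h] := pselect (exists c, code c = n); last first.
  by move: hn; rewrite s_notcode ?ltNge ?hn'// => c cn; apply: h; exists c.
exists c; rewrite in_itv/= lft_rcons -addrA -s_code cn -lerBrDl hn' /=.
by rewrite -ltrBlDl.
Qed.

Let I_uniq w c c' t : I (rcons w c) t -> I (rcons w c') t -> c = c'.
Proof.
rewrite /I /= !in_itv/= !lft_rcons -!addrA -!s_code -!lerBrDl -!ltrBlDl.
move=> /andP[a b] /andP[a' b']; apply: code_inj; apply/eqP.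
rewrite eqn_leq; apply/andP; split; rewrite leqNgt; apply/negP => h.
  by have := lt_le_trans b' (le_trans (s_nd w h) a); rewrite ltxx.
by have := lt_le_trans b (le_trans (s_nd w h) a'); rewrite ltxx.
Qed.

(** The first letters read off by [t]. The default [point] of [xget] is never taken when [t] lies in
    [I [::]]. *)
Let pre t := fix pre n := if n is m.+1 then
  rcons (pre m) (xget point [set c | I (rcons (pre m) c) t]) else [::].

Let dig t n := xget point [set c | I (rcons (pre t n) c) t].

Let blk_dig t n : blk (dig t) 0 n = pre t n.
Proof. by elim: n => // n IH; rewrite blkS IH. Qed.

Let I_nil : I [::] = `[0, 1[%classic.
Proof. by rewrite /I /lft big_ord0 add0r p_nil. Qed.

Let I_pre t n : I [::] t -> I (pre t n) t.
Proof. by move=> t01; elim: n => //= n /I_split[c Ic]; case: xgetP => // /(_ c). Qed.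

Let I_sub01 w : I w `<=` I [::].
Proof. by elim/last_ind: w => // w c IH t /I_sub /IH. Qed.

Let I_eq_pre t w : I w t -> w = pre t (size w).
Proof.
elim/last_ind: w => // w c IH It; rewrite size_rcons /=.
rewrite -(IH (I_sub It)); congr rcons.
by case: xgetP => [x _ Ix|/(_ c)//]; exact: I_uniq It Ix.
Qed.

(** Outside the unit interval the map is constant, so a cylinder pulls back there to everything or
    to nothing; measurability is then immediate, and the uniform law ignores this part. *)
Let zeta (t : measurableTypeR R) : seqsp P := if t \in I [::] then dig t else fun=> point.

Let zeta_cyl w : zeta @^-1` cyl w `&` I [::] = I w.
Proof.
apply/seteqP; split => t.
  by case=> + t01; rewrite /zeta /cyl /= mem_set// blk_dig => <-; exact: I_pre.
move=> It; have t01 := I_sub01 It; split => //.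
by rewrite /zeta /cyl /= mem_set// blk_dig -I_eq_pre.
Qed.

Let mI w : measurable (I w).
Proof. exact: measurable_itv. Qed.

Let mzeta : measurable_fun [set: measurableTypeR R] zeta.
Proof.
apply: measurable_fun_seqsp => w; rewrite -[X in measurable X]setIT -(setUv (I [::])) setIUr.
apply: measurableU; first (rewrite zeta_cyl; exact: mI).
rewrite (_ : _ `&` _ = if `[< cyl w (fun=> point) >] then ~` I [::] else set0).
  by case: ifP => _; [apply: measurableC; exact: mI|].
case: asboolP => h; apply/seteqP; split => t //=.
- by case.
- by move=> nt; split => //; rewrite /zeta memNset.
- by rewrite /zeta => -[+ nt]; rewrite memNset.
Qed.

Let uniform_I w : uniform_prob (@ltr01 R) (I w) = (p w)%:E.
Proof.
rewrite /uniform_prob integral_uniform_pdf setIidl; last first.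
  by move=> t /I_sub01; rewrite I_nil /= !in_itv/= => /andP[-> /ltW].
rewrite (eq_integral (fun=> 1%:E)); last first.
  move=> t; rewrite inE => /I_sub01; rewrite I_nil /= in_itv/= => /andP[t0 t1].
  by rewrite /uniform_pdf t0 (ltW t1) subr0 invr1.
rewrite integral_cst ?mul1e; last exact: mI.
rewrite /= /I lebesgue_measure_itv/= lte_fin ltrDl lt_neqAle p_ge0 andbT.
by case: eqP => [<-|_] //=; rewrite -EFinB addrAC subrr add0r.
Qed.

HB.instance Definition _ := isMeasurableFun.Build _ _ _ _ zeta mzeta.

(** The law of [zeta] under the uniform distribution: up to a null set, the preimage of [cyl w] is
    [I w]. *)
Lemma sequence_measure_exists : exists m : probability (seqsp P) R,
  forall w, m (cyl w) = (p w)%:E.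
Proof.
exists (distribution (uniform_prob (@ltr01 R)) zeta) => w.
pose U : probability (measurableTypeR R) R := uniform_prob (@ltr01 R).
have mz : measurable (zeta @^-1` cyl w).
  by rewrite -[X in measurable X]setTI; apply: mzeta => //; exact: measurable_cyl.
transitivity (U (zeta @^-1` cyl w)) => //.
rewrite -[_ @^-1` _]setIT -(setUv (I [::])) setIUr measureU0 ?zeta_cyl//.
- exact: uniform_I.
- exact: mI.
- by apply: measurableI => //; apply: measurableC; exact: mI.
- apply/eqP; rewrite -measure_le0.
  apply: (@le_trans _ _ (U (~` I [::]))).
    apply: le_measure; rewrite ?inE; last exact: subIsetr.
      by apply: measurableI => //; apply: measurableC; exact: mI.
    by apply: measurableC; exact: mI.
  rewrite probability_setC; last exact: mI.
  by rewrite [X in (_ - X)%E](_ : _ = 1%:E) ?subee//; rewrite -p_nil; exact: uniform_I.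
Qed.

End SequenceMeasure.

(** * The empirical measure of a sequence along an ultrafilter *)

Lemma blk_shiftn {A : Type} (x : nat -> A) k n : blk (shiftn k x) 0 n = blk x k n.
Proof. by apply: eq_map => i; rewrite /shiftn add0n addnC. Qed.

Definition visits {A : Type} (z : nat -> A) (C : set (nat -> A)) : set nat :=
  [set k | C (shiftn k z)].

Lemma occE {A : Type} (x : nat -> A) w n : occ x w n = dens_count (visits x (cyl w)) n.
Proof. by apply: eq_bigr => k _; rewrite /visits /cyl /= blk_shiftn. Qed.

Lemma cyl_nil (A : Type) : cyl [::] = setT :> set (nat -> A).
Proof. by apply/seteqP; split. Qed.

Lemma cyl_rcons (A : Type) (w : seq A) c :
  cyl (rcons w c) = cyl w `&` [set y | y (size w) = c].
Proof.
apply/seteqP; split => y; rewrite /cyl /= size_rcons blkS add0n.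
  by move/rcons_inj => [-> ->].
by move=> [-> ->].
Qed.

Lemma visits_rcons (A : Type) (z : nat -> A) (w : seq A) c :
  visits z (cyl (rcons w c)) = visits z (cyl w) `&` [set k | z (k + size w)%N = c].
Proof. by rewrite /visits cyl_rcons; apply/funext => k; rewrite /= addnC. Qed.

(** The longer word fixes every coordinate that the shorter one reads. Hence two cylinders that meet
    are nested, and adding the empty set makes cylinders stable under intersection. *)
Lemma cyl_sub (A : Type) (u v : seq A) y :
  (size u <= size v)%N -> cyl u y -> cyl v y -> cyl v `<=` cyl u.
Proof.
move=> uv; rewrite /cyl /= => yu yv t /= tv.
have take_blk (x : nat -> A) : blk x 0 (size u) = take (size u) (blk x 0 (size v)).
  by rewrite /blk -map_take take_iota (minn_idPl uv).
by rewrite /= take_blk tv -yv -take_blk.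
Qed.

Lemma seqsp_measure_unique (R : realType) (A : pointedType)
    (m1 m2 : probability (seqsp A) R) :
  (forall w, m1 (cyl w) = m2 (cyl w)) ->
  forall E, measurable E -> m1 E = m2 E.
Proof.
move=> m12 E mE.
apply: (@g_sigma_algebra_measure_unique _ R (seqsp A) (set0 |` @cylinders A) _ (fun=> setT)).
- by move=> _ [->|[w _ <-]]; [exact: measurable0|exact: measurable_cyl].
- by move=> i; right; exists [::] => //; exact: cyl_nil.
- by rewrite bigcup_const//; exists 0%N.
- have sub u v : (size u <= size v)%N ->
      (set0 |` @cylinders A) (cyl u `&` cyl v).
    move=> uv; have [[y [yu yv]]|h] := pselect (exists y, cyl u y /\ cyl v y).
      by right; exists v => //; rewrite setIidr//; exact: cyl_sub yu yv.
    by left; apply/seteqP; split => // y [yu yv]; apply: h; exists y.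
  move=> A1 A2 [->|[u _ <-]]; first by move=> _; rewrite set0I; left.
  move=> [->|[v _ <-]]; first by rewrite setI0; left.
  by have [uv|/ltnW vu] := leqP (size u) (size v); [|rewrite setIC]; exact: sub.
- by move=> _ [->|[w _ <-]]; [rewrite !measure0|exact: m12].
- by move=> _; apply: (@le_lt_trans _ _ (m1 setT)) => //; rewrite (probability_setT m1) ltry.
- apply: (smallest_sub (smallest_sigma_algebra _ _) _ mE).
  by move=> B BC; apply: sub_sigma_algebra; right.
Qed.

Section Empirical.
Variables (R : realType) (F : set_system nat).
Context {FU : UltraFilter F}.
Hypothesis Foo : \oo `<=` F.
Variables (P : pointedType) (code : P -> nat) (z : nat -> P).
Hypothesis code_inj : injective code.
Local Notation dens := (dens R F).

(** As [dens] is only finitely additive, mass could escape to letters of ever larger code; this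
    condition says that none does. *)
Definition tight := (fun n => dens [set k | code (z k) < n]%N) @ \oo --> (1 : R).

(** The density lost is at most that of the [k] with [code (z (k + m)) >= n]. Shift invariance makes
    this independent of [m], and it tends to [0]. *)
Lemma tight_cvg E m : tight ->
  (fun n => dens (E `&` [set k | code (z (k + m)%N) < n]%N)) @ \oo --> dens E.
Proof.
move=> tz; apply: (@squeeze_cvgr _ _ _ _ (fun n => dens E - (1 - dens [set k | code (z k) < n]%N)) (fun=> dens E)).
- apply: nearW => n; apply/andP; split; last by apply: dens_mono; exact: subIsetl.
  set B := [set k | code (z (k + m)%N) < n]%N.
  have -> : dens [set k | (code (z k) < n)%N] = dens B.
    by apply/esym; exact: (dens_shiftn R Foo [set k | (code (z k) < n)%N] m).
  have := @densID R F FU E B; have := @densID R F FU setT B; have := @densT R F FU Foo; rewrite !setTI.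
  have : dens (E `&` ~` B) <= dens (~` B) by apply: dens_mono; exact: subIsetr.
  by lra.
- rewrite -[X in _ --> X]subr0 -(subrr (1 : R)); apply: cvgB; first exact: cvg_cst.
  by apply: cvgB => //; exact: cvg_cst.
- exact: cvg_cst.
Qed.

(** Finite additivity of [dens] gives the partial sums over children of a word; tightness makes them
    converge to the density of the word itself. *)
Lemma empirical_measure_exists : tight ->
  exists m : probability (seqsp P) R,
    forall w, m (cyl w) = (dens (visits z (cyl w)))%:E.
Proof.
move=> tz.
apply: (@sequence_measure_exists R P code _
  (fun w n => dens (visits z (cyl w) `&` [set k | code (z (k + size w)%N) < n]%N))) => //.
- by rewrite /visits cyl_nil; exact: densT.
- by move=> w; exact: dens_ge0.
- by move=> w; rewrite (_ : _ `&` _ = set0) ?dens0//; apply/seteqP; split => // k [].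
- move=> w c; rewrite visits_rcons -densU; last first.
    by apply/seteqP; split => // k /= [[_ h] [_ zc]]; rewrite zc ltnn in h.
  rewrite -setIUr; congr (dens (_ `&` _)); apply/seteqP; split => k /=.
    by rewrite ltnS leq_eqVlt => /orP[/eqP/code_inj|]; [right|left].
  by move=> [|->]; rewrite ltnS//; exact: ltnW.
- move=> w j hj; congr dens; apply/seteqP; split => k /= [wk h]; split => //; last exact: ltnW.
  by move: h; rewrite ltnS leq_eqVlt => /orP[/eqP/hj|].
- by move=> w; exact: tight_cvg.
Qed.

Variable m : probability (seqsp P) R.
Hypothesis m_cyl : forall w, m (cyl w) = (dens (visits z (cyl w)))%:E.

(** This class is not closed under countable unions in general, because [dens] is only finitely
    additive. The next lemmas enlarge it one coordinate at a time, using tightness. *)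
Let good (C : set (seqsp P)) := measurable C /\ m C = (dens (visits z C))%:E.

Let good0 : good set0.
Proof. by split => //; rewrite measure0 /visits dens0. Qed.

Let goodU A B : A `&` B = set0 -> good A -> good B -> good (A `|` B).
Proof.
move=> AB [mA hA] [mB hB]; split; first exact: measurableU.
have -> : m (A `|` B) = (m A + m B)%E by rewrite measureU.
rewrite hA hB -EFinD -densU//.
apply/seteqP; split => // k [Ak Bk].
by have : (A `&` B) (shiftn k z) by []; rewrite AB.
Qed.

Let good_lt C j n : (forall c, good (C `&` [set y | y j = c])) ->
  good (C `&` [set y | code (y j) < n]%N).
Proof.
move=> gC; elim: n => [|n IH].
  by rewrite (_ : _ `&` _ = set0)//; apply/seteqP; split => // y [].
have [[c cn]|h] := pselect (exists c, code c = n); last first.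
  rewrite (_ : [set y | _] = [set y | (code (y j) < n)%N])//.
  apply/seteqP; split => y /=; last exact: ltnW.
  by rewrite ltnS leq_eqVlt => /orP[/eqP yn|//]; case: h; exists (y j).
rewrite (_ : _ `&` _ = (C `&` [set y | code (y j) < n]%N) `|` (C `&` [set y | y j = c])).
  by apply: goodU => //; apply/seteqP; split => // y /= [[_ +] [_ yc]]; rewrite yc cn ltnn.
rewrite -setIUr; congr (_ `&` _); apply/seteqP; split => y /=.
  by rewrite ltnS leq_eqVlt -cn => /orP[/eqP/code_inj|]; [right|left].
by move=> [|->]; rewrite -cn ltnS//; exact: ltnW.
Qed.

Let lt_exhaust (C : set (seqsp P)) j :
  C = \bigcup_n (C `&` [set y : seqsp P | code (y j) < n]%N).
Proof.
apply/seteqP; split => y; last by case=> n _ [].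
by move=> Cy; exists (code (y j)).+1 => //; split => //=.
Qed.

Let good_cvg (C : set (seqsp P)) j : (forall n, measurable (C `&` [set y : seqsp P | code (y j) < n]%N)) ->
  (fun n => m (C `&` [set y : seqsp P | code (y j) < n]%N)) @ \oo --> m C.
Proof.
move=> mC; rewrite {2}(lt_exhaust C j); apply: nondecreasing_cvg_mu => //.
  by apply: bigcupT_measurable.
move=> a b ab; apply/subsetPset; apply: setIS => y /= ya; exact: leq_trans ya ab.
Qed.

(** Converse of the existence result: [m] is countably additive of mass [1], so the masses of the
    letters of code below [n] tend to [1], and these masses are densities. *)
Lemma empirical_tight : tight.
Proof.
have h n : good (setT `&` [set y | code (y 0%N) < n]%N).
  apply: good_lt => c; rewrite setTI (_ : [set y | _] = cyl [:: c]).
    by split => //; exact: measurable_cyl.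
  by rewrite -[[:: c]]/(rcons [::] c) cyl_rcons cyl_nil setTI.
have : (fun n => fine (m (setT `&` [set y : seqsp P | code (y 0%N) < n]%N))) @ \oo --> fine (m setT).
  by apply: fine_cvg; rewrite fineK ?fin_num_measure//; apply: good_cvg => n; have [] := h n.
rewrite probability_setT /tight; under eq_cvg do rewrite (proj2 (h _)) setTI.
exact.
Qed.

(** Truncate by the code of coordinate [j] and let the bound grow: [m] converges by continuity from
    below, [dens] by tightness, and the limits agree. *)
Let good_step C j : (forall c, good (C `&` [set y | y j = c])) -> good C.
Proof.
move=> gC; have gn n := good_lt n gC; have mn n := proj1 (gn n).
split; first by rewrite (lt_exhaust C j); apply: bigcupT_measurable.
have h1 := good_cvg mn.
apply: (cvg_unique _ h1); first exact: ereal_hausdorff.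
rewrite (_ : (fun n => _) = EFin \o (fun n => dens (visits z C `&`
   [set k | code (z (k + j)%N) < n]%N))).
  by apply: cvg_EFin; [exact: nearW|apply: tight_cvg; exact: empirical_tight].
apply/funext => n; rewrite (proj2 (gn n)) /=; congr (dens _)%:E.
by rewrite /visits; apply/seteqP; split => k /=; rewrite /shiftn addnC.
Qed.

(* Refine C by cylinders of length n; both sides are countably additive along a
   letter, [dens] by tightness. *)
Lemma empirical_finite_dim (n : nat) (C : set (seqsp P)) :
  (forall y y', (forall i, (i < n)%N -> y i = y' i) -> C y -> C y') ->
  measurable C /\ m C = (dens (visits z C))%:E.
Proof.
move=> Cn; rewrite -/(good C) -[C]setIT -(cyl_nil P).
suff h d w : (size w + d = n)%N -> good (C `&` cyl w) by exact: (h n).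
elim: d w => [|d IH] w wn.
  have [[y [Cy wy]]|h] := pselect (exists y, C y /\ cyl w y); last first.
    rewrite (_ : _ `&` _ = set0)//; apply/seteqP; split => // y [Cy wy].
    by apply: h; exists y.
  rewrite (_ : _ `&` _ = cyl w); first by split => //; exact: measurable_cyl.
  rewrite setIidr// => t wt; apply: Cn Cy => i; rewrite -wn addn0 => iw.
  rewrite /cyl /= in wy wt.
  have nth_blk (x : nat -> P) : nth point (blk x 0 (size w)) i = x i.
    by rewrite (nth_map 0%N) ?size_iota// nth_iota.
  by rewrite -nth_blk wy -wt nth_blk.
apply: (good_step (j := size w)) => c.
by rewrite -setIA -cyl_rcons; apply: IH; rewrite size_rcons addSnnS.
Qed.

End Empirical.

(** * Averages of continuous functions on the Cantor space *)

(** The topology is the supremum of those pulled back along the coordinates, so each coordinate can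
    be treated alone. *)
Lemma cantor_cvg (G : set_system nat) (w : nat -> cantor_space) (t : cantor_space) :
  Filter G -> (forall i, G [set k | w k i = t i]) -> w @ G --> t.
Proof.
move=> FG h; apply/cvg_sup => N U [V] [[W] oW <-] WfN WU.
apply: (filterS WU); rewrite nbhs_simpl.
by apply: (@filterS _ G _ _ _ _ (h N)) => k /= wk; rewrite /= /proj wk.
Qed.

Lemma cvg_cantor_coord (G : set_system nat) (w : nat -> cantor_space) (t : cantor_space) i :
  Filter G -> w @ G --> t -> G [set k | w k i = t i].
Proof.
move=> FG wt.
have h : (fun u : cantor_space => u i) @ t --> t i.
  exact: (@proj_continuous nat (fun=> bool) i).
have := cvg_comp _ _ wt h.
by move=> /(_ [set t i]); apply; exact: discrete_set1.
Qed.

(** Otherwise there are [u k] and [v k] agreeing on the first [k] coordinates with values at least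
    [e] apart. Along an ultrafilter [u] converges by compactness, [v] has the same limit, and
    continuity of [f] is contradicted. *)
Lemma cantor_unif_continuous (R : realType) (f : cantor_space -> R) (e : R) :
  continuous f -> 0 < e ->
  exists n, forall u v : nat -> bool, (forall i, (i < n)%N -> u i = v i) -> `|f u - f v| < e.
Proof.
move=> cf e0; apply: contrapT => hN.
have /choice[uv huv] : forall n, exists uv : cantor_space * cantor_space,
    (forall i, (i < n)%N -> uv.1 i = uv.2 i) /\ e <= `|f uv.1 - f uv.2|.
  move=> n; apply: contrapT => h; apply: hN; exists n => u v huv.
  by rewrite ltNge; apply/negP => fuv; apply: h; exists (u, v).
have [G [GU Goo]] := ultraFilterLemma eventually_filter.
pose u := fst \o uv; pose v := snd \o uv.
have := cantor_space_compact; rewrite compact_ultra => /(_ (u @ G)) [||t [_ ut]].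
- exact: ultra_fmap.
- exact: filterT.
have vt : v @ G --> t.
  apply: cantor_cvg => i.
  have ev : G [set k | (i < k)%N] by apply: Goo; exists i.+1.
  have ui : G [set k | u k i = t i] by exact: cvg_cantor_coord ut.
  by apply: filterS (filterI ui ev) => k /= [uki ik]; rewrite /v /= -(proj1 (huv k)).
have h : (fun k => f (u k) - f (v k)) @ G --> f t - f t.
  by apply: cvgB; [exact: (cvg_comp _ _ ut (cf t))|exact: (cvg_comp _ _ vt (cf t))].
have /cvgr_dist_lt /(_ e e0) : (fun k => f (u k) - f (v k)) @ G --> (0 : R).
  by move: h; rewrite subrr.
move=> /filter_ex[k]; rewrite sub0r normrN.
by rewrite ltNge (proj2 (huv k)).
Qed.

Section Averages.
Variables (R : realType) (F : set_system nat).
Context {FU : UltraFilter F}.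
Variables (nu : probability (seqsp bool) R) (y : nat -> bool).
Hypothesis nu_cyl : forall w, nu (cyl w) = (dens R F (visits y (cyl w)))%:E.

Definition avg (f : (nat -> bool) -> R) (n : nat) : R :=
  (\sum_(i < n) f (shiftn i y)) / n%:R.

(** Integrability is carried along because linearity of the real-valued integral requires it. *)
Let Q (f : seqsp bool -> R) :=
  nu.-integrable setT (EFin \o f) /\ avg f @ F --> \int[nu]_x f x.

Let QD f g : Q f -> Q g -> Q (fun u => f u + g u).
Proof.
move=> [fi fc] [gi gc]; split.
  rewrite (_ : EFin \o _ = (EFin \o f) \+ (EFin \o g))%E; last exact/funext.
  exact: integrableD.
rewrite RintegralD// (_ : avg _ = avg f \+ avg g); first exact: cvgD.
by apply/funext => n; rewrite /avg /= big_split mulrDl.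
Qed.

Let QZ c f : Q f -> Q (fun u => c * f u).
Proof.
move=> [fi fc]; split.
  rewrite (_ : EFin \o _ = (fun x => c%:E * (EFin \o f) x))%E; last exact/funext.
  exact: integrableZl.
rewrite RintegralZl// (_ : avg _ = (fun n => c * avg f n)); first by apply: cvgMr; exact: fc.
by apply/funext => n; rewrite /avg /= -mulr_sumr mulrA.
Qed.

Let Q_cyl w : Q (\1_(cyl w : set (seqsp bool))).
Proof.
have mw : measurable (cyl w : set (seqsp bool)) by exact: measurable_cyl.
split; first exact: integrable_indic.
have I : (\int[nu]_x (\1_(cyl w : set (seqsp bool)) x)%:E = nu (cyl w))%E.
  by rewrite integral_indic// setIT.
rewrite /Rintegral I nu_cyl /=.
rewrite (_ : avg _ = freq R (visits y (cyl w))); first exact: dens_cvg.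
apply/funext => n; rewrite /avg /freq /dens_count natr_sum; congr (_ / _).
Qed.

Let Q_sum (I : Type) (r : seq I) (f : I -> seqsp bool -> R) :
  (forall i, Q (f i)) -> Q (fun u => \sum_(i <- r) f i u).
Proof.
move=> Qf; elim: r => [|i r IH].
  rewrite (_ : (fun u => _) = (fun u => 0 * \1_(cyl [::]) u)); first exact: QZ.
  by apply/funext => u; rewrite big_nil mul0r.
rewrite (_ : (fun u => _) = (fun u => f i u + \sum_(i <- r) f i u)); first exact: QD.
by apply/funext => u; rewrite big_cons.
Qed.

(** Such a [g] is a finite linear combination of indicators of cylinders of length [n]. Padding
    words by [false] in [ext] is harmless, since [g] reads only the first [n] coordinates. *)
Let Q_finite_dim n (g : seqsp bool -> R) :
  (forall u v, (forall i, (i < n)%N -> u i = v i) -> g u = g v) -> Q g.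
Proof.
move=> gn; pose ext (v : n.-tuple bool) (i : nat) := nth false v i.
rewrite (_ : g = fun u => \sum_(v : n.-tuple bool) g (ext v) * \1_(cyl v) u).
  by apply: Q_sum => v; apply: QZ; exact: Q_cyl.
apply/funext => u.
have su : size (blk u 0 n) == n by rewrite size_blk.
rewrite (bigD1 (Tuple su)) //= big1 ?addr0.
  rewrite indicE mem_set ?mulr1; last by rewrite /cyl /= size_blk.
  by apply: gn => i iltn; rewrite /ext /= (nth_map 0%N) ?size_iota// nth_iota.
move=> v vu; rewrite indicE memNset ?mulr0// /cyl /= size_tuple => uv.
by move/eqP: vu; apply; apply: val_inj => /=.
Qed.

(** Replacing all coordinates from [n] on by [false] approximates [f] uniformly by functions of
    finitely many coordinates, for which [Q] is known. *)
Lemma avg_continuous_cvg (f : cantor_space -> R) : continuous f ->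
  nu.-integrable setT (EFin \o (f : seqsp bool -> R)) /\
  avg f @ F --> \int[nu]_x (f : seqsp bool -> R) x.
Proof.
move=> cf.
have approx e : 0 < e -> exists g, Q g /\ forall u, `|f u - g u| < e.
  move=> e0; have [n hn] := cantor_unif_continuous cf e0.
  exists (fun u => f (fun i => if (i < n)%N then u i else false)); split.
    apply: (@Q_finite_dim n) => u v uv; congr f; apply/funext => i.
    by case: ifP => // /uv.
  by move=> u; apply: hn => i ->.
have mf : measurable_fun [set: seqsp bool] (f : seqsp bool -> R).
  have /choice[h hh] : forall n : nat, exists g, Q g /\ forall u, `|f u - g u| < n.+1%:R^-1.
    by move=> n; apply: approx; rewrite invr_gt0.
  apply: (@measurable_fun_cvg _ _ _ _ h).
    by move=> n; have [[/integrableP[/measurable_EFinP]]] := hh n.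
  move=> u _; apply/cvgrPdist_lt => e e0; near=> n.
  apply: (lt_le_trans (proj2 (hh n) u)).
  by apply: ltW; near: n; exact: near_infty_natSinv_lt (PosNum e0).
have [g1 [[g1i _] g1f]] := approx 1 ltr01.
have fi : nu.-integrable setT (EFin \o (f : seqsp bool -> R)).
  apply: (@le_integrable _ _ _ _ _ measurableT _ (fun u => (1 + `|g1 u|)%:E)).
  - exact/measurable_EFinP.
  - move=> u _ /=; rewrite lee_fin [leRHS]ger0_norm ?addr_ge0//.
    by rewrite -[f u](subrK (g1 u)) (le_trans (ler_normD _ _))// lerD2r ltW.
  - rewrite (_ : (fun u => _) = (fun u => (EFin \o cst 1%R) u + (abse \o (EFin \o g1)) u)%E).
      apply: integrableD => //; first exact: finite_measure_integrable_cst.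
      exact: integrable_abse.
    exact/funext.
split=> //.
have avgB g n e : (forall u, `|f u - g u| < e) -> 0 < e -> `|avg f n - avg g n| <= e.
  move=> fg e0; rewrite /avg -mulrBl -sumrB normrM [X in _ * X]ger0_norm ?invr_ge0//.
  case: n => [|n]; first by rewrite invr0 mulr0 ltW.
  rewrite ler_pdivrMr// (le_trans (ler_norm_sum _ _ _))//.
  rewrite mulr_natr -[n.+1 in leRHS]card_ord -sumr_const.
  by apply: ler_sum => i _; exact: ltW.
have intB g e : (forall u, `|f u - g u| < e) -> Q g ->
    `|\int[nu]_x (f : seqsp bool -> R) x - \int[nu]_x g x| <= e.
  move=> fg [gi _]; rewrite -RintegralB//.
  have ci (c : R) : nu.-integrable setT (EFin \o (cst c : seqsp bool -> R)).
    exact: finite_measure_integrable_cst.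
  have Ic (c : R) : \int[nu]_x (cst c : seqsp bool -> R) x = c.
    by rewrite Rintegral_cst// -[fine _]/(fine (nu setT)) probability_setT mulr1.
  have di : nu.-integrable setT (EFin \o (fun u : seqsp bool => f u - g u)).
    rewrite (_ : EFin \o _ = (fun u => (EFin \o f) u - (EFin \o g) u)%E); last exact/funext.
    exact: integrableB.
  rewrite ler_norml -{1}(Ic (- e)) -{2}(Ic e); apply/andP; split.
    by apply: le_Rintegral => // u _; have := fg u; rewrite ltr_norml => /andP[/ltW].
  by apply: le_Rintegral => // u _; have := fg u; rewrite ltr_norml => /andP[_ /ltW].
apply/cvgrPdist_le => e e0.
(* One third each for replacing [f] by [g] in the average, doing so in the integral, and the
   convergence for [g]. *)
have e3 : 0 < e / 3 by rewrite divr_gt0.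
have [g [[gi gc] gf]] := approx _ e3.
move/cvgrPdist_le : (gc) => /(_ _ e3); apply: filterS => n hn.
have h1 := avgB g n _ gf e3; have h2 := intB g _ gf (conj gi gc).
move: h1 h2 hn; rewrite !ler_norml => /andP[? ?] /andP[? ?] /andP[? ?].
by apply/andP; split; lra.
Unshelve. all: end_near. Qed.

End Averages.

(** * The joining *)

Section PushforwardProbability.
Context d d' (T : measurableType d) (T' : measurableType d') (R : realType).
Variables (m : probability T R) (f : T -> T').
Hypothesis mf : measurable_fun setT f.

Let f' := f.
HB.instance Definition _ := isMeasurableFun.Build _ _ _ _ f' mf.

Lemma pushforward_probability : exists m' : probability T' R,
  forall E, m' E = m (f @^-1` E).
Proof. by exists (distribution m f'). Qed.

End PushforwardProbability.

Lemma cyl_coord (A : Type) (w : seq A) (y y' : nat -> A) :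
  (forall i, (i < size w)%N -> y i = y' i) -> cyl w y -> cyl w y'.
Proof.
rewrite /cyl /= => yy' yw; rewrite -[RHS]yw; apply/eq_in_map => i.
by rewrite mem_iota /= add0n => /yy' ->.
Qed.

Lemma shift_shiftn (A : Type) (z : nat -> A) k : Defs.shift (shiftn k z) = shiftn k.+1 z.
Proof. by apply/funext => n; rewrite /Defs.shift /shiftn addSnnS. Qed.

Section EmpiricalMaps.
Variables (R : realType) (F : set_system nat).
Context {FU : UltraFilter F}.
Hypothesis Foo : \oo `<=` F.
Variables (P : pointedType) (code : P -> nat) (z : nat -> P).
Hypothesis code_inj : injective code.
Variable m : probability (seqsp P) R.
Hypothesis m_cyl : forall w, m (cyl w) = (dens R F (visits z (cyl w)))%:E.

(** The preimage of [cyl w] depends only on the first [size w] coordinates, although over an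
    infinite alphabet it may be an infinite union of cylinders. *)
Lemma empirical_comp (A : pointedType) (g : P -> A) :
  measurable_fun setT ((fun y n => g (y n)) : seqsp P -> seqsp A) /\
  forall w, m ((fun y n => g (y n)) @^-1` cyl w) =
    (dens R F (visits (fun n => g (z n)) (cyl w)))%:E.
Proof.
have h w : measurable ((fun y n => g (y n)) @^-1` cyl w : set (seqsp P)) /\
    m ((fun y n => g (y n)) @^-1` cyl w) =
    (dens R F (visits z ((fun y n => g (y n)) @^-1` cyl w)))%:E.
  apply: (empirical_finite_dim Foo code_inj m_cyl (n := size w)) => y y' yy'.
  by apply: cyl_coord => i /yy' ->.
by split=> [|w]; [apply: measurable_fun_seqsp => w|]; have [] := h w.
Qed.

(** On cylinders this is shift invariance of [dens]; uniqueness of measures with given cylinder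
    masses extends it. *)
Lemma empirical_shift_invariant :
  measurable_fun setT (Defs.shift : seqsp P -> seqsp P) /\
  forall E : set (seqsp P), measurable E -> m ((Defs.shift : seqsp P -> seqsp P) @^-1` E) = m E.
Proof.
have h w : measurable (Defs.shift @^-1` cyl w : set (seqsp P)) /\
    m (Defs.shift @^-1` cyl w) = (dens R F (visits z (Defs.shift @^-1` cyl w)))%:E.
  apply: (empirical_finite_dim Foo code_inj m_cyl (n := (size w).+1)) => y y' yy'.
  by apply: cyl_coord => i iw; apply: yy'.
have ms : measurable_fun setT (Defs.shift : seqsp P -> seqsp P).
  by apply: measurable_fun_seqsp => w; have [] := h w.
split=> // E mE; have [m' hm'] := pushforward_probability m ms.
rewrite -hm'; apply: seqsp_measure_unique mE => w; rewrite hm' (proj2 (h w)) m_cyl -(dens_shift R Foo (visits z (cyl w))).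
congr (dens _ _ _)%:E; apply/funext => k.
by rewrite /visits /= shift_shiftn.
Qed.

End EmpiricalMaps.

(** * The density formula for a letter along [S], for one ultrafilter *)

Section Main.
Variables (R : realType) (L : pointedType).
Hypothesis hL : countable [set: L].
Variable mu : probability (seqsp L) R.
Variable S : set nat.
Hypothesis hdisj : forall nu : probability (seqsp bool) R,
  derived_from S nu -> disjoint_measures mu nu.
Variable x : nat -> L.
Hypothesis mux : normal mu x.

Lemma ultra_dens_product (F : set_system nat) (a : L) : UltraFilter F -> \oo `<=` F ->
  dens R F (S `&` [set k | x k = a]) = fine (mu (cyl [:: a])) * dens R F S.
Proof.
move=> FU Foo.
have /countable_injP[codeL codeL_inj'] := hL.
have codeL_inj : injective codeL by move=> u v uv; apply: codeL_inj' => //; rewrite inE.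
pose P : pointedType := (L * bool)%type.
(* Doubling leaves the parity free to record the bit. *)
pose code (c : P) := (codeL c.1 * 2 + c.2)%N.
have code_inj : injective code.
  move=> [u1 u2] [v1 v2]; rewrite /code /= => uv; have : codeL u1 = codeL v1 /\ u2 = v2.
    by move: uv; case: u2; case: v2 => /= uv; split => //; lia.
  by move=> [/codeL_inj -> ->].
pose y := indic_seq S; pose z n : P := (x n, y n).
have mu_cyl w : mu (cyl w) = (dens R F (visits x (cyl w)))%:E.
  rewrite -[LHS]fineK ?fin_num_measure//; last exact: measurable_cyl.
  congr _%:E; apply/esym; apply: dens_normal => //.
  have -> : freq R (visits x (cyl w)) = (fun n => (occ x w n)%:R / n%:R).
    by apply/funext => n; rewrite /freq -occE.
  exact: mux.
have tx : tight R F codeL x by exact: empirical_tight mu_cyl.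
(* If [x k] has code below [N], then [z k] has code below [2 N], whatever the bit. *)
have tz : tight R F code z.
  apply/cvgrPdist_lt => e e0; move/cvgrPdist_lt : (tx) => /(_ e e0) [N _ hN].
  exists (N * 2)%N => // n /= Nn; have := hN N (leqnn N); rewrite /=.
  have dle E : dens R F E <= 1 by rewrite -(densT R Foo); exact: dens_mono.
  rewrite !ger0_norm ?subr_ge0//; apply: le_lt_trans; rewrite lerD2l lerN2.
  apply: dens_mono => k /= xk; apply: leq_trans Nn; rewrite /code /z /=.
  by case: (y k); lia.
have [lam0 lam0_cyl] := @empirical_measure_exists R F FU Foo P code z code_inj tz.
have [ms inv0] := @empirical_shift_invariant R F FU Foo P code z code_inj lam0 lam0_cyl.
have [mfst lam0_fst] := @empirical_comp R F FU Foo P code z code_inj lam0 lam0_cyl _ (@fst L bool).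
have [msnd lam0_snd] := @empirical_comp R F FU Foo P code z code_inj lam0 lam0_cyl _ (@snd L bool).
have [nu hnu] := pushforward_probability lam0 msnd.
have nu_cyl w : nu (cyl w) = (dens R F (visits y (cyl w)))%:E by rewrite hnu lam0_snd.
(* For finitely many test functions the set of good times belongs to [F]. It meets every tail, as
   [F] contains the cofinite sets, so good times occur arbitrarily late. *)
have derived : derived_from S nu.
  move=> n f e cf e0 N.
  have h j : F [set k | `|\int[nu]_u (f j : seqsp bool -> R) u - avg y (f j) k| < e].
    have [_ /cvgrPdist_lt] := @avg_continuous_cvg R F FU nu y nu_cyl (f j) (cf j).
    by apply.
  have hall : F [set k | forall j, `|\int[nu]_u (f j : seqsp bool -> R) u - avg y (f j) k| < e].
    exact: filter_forall.
  have hN : F [set k | (maxn N 1 <= k)%N] by apply: Foo; exists (maxn N 1).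
  have [k [/= kall]] := filter_ex (filterI hall hN).
  rewrite geq_max => /andP[Nk k0]; exists k => // j.
  have [fi _] := @avg_continuous_cvg R F FU nu y nu_cyl (f j) (cf j).
  have -> : (\int[nu]_u (f j u)%:E = (\int[nu]_u (f j : seqsp bool -> R) u)%:E)%E.
    by rewrite /Rintegral fineK//; exact: integrable_fin_num.
  by rewrite -EFinB /= lte_fin; exact: kall.
pose unzip (u : seqsp P) : (seqsp L * seqsp bool)%type :=
  ((fun n => (u n).1), (fun n => (u n).2)).
have munzip : measurable_fun setT unzip by exact: measurable_fun_pair.
have [lam hlam] := pushforward_probability lam0 munzip.
have joint : joining mu nu lam.
  split=> E mE; rewrite !hlam.
  - rewrite -[RHS]inv0 //; rewrite -[X in measurable X]setTI; exact: munzip.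
  (* Normality of [x] enters here: [mu] and the first marginal both give each cylinder its visit
     density along [x]. *)
  - have [m1 hm1] := pushforward_probability lam0 mfst.
    transitivity (m1 E); first by rewrite hm1.
    by apply: seqsp_measure_unique mE => w; rewrite hm1 lam0_fst mu_cyl.
  - by rewrite hnu.
have ma := measurable_cyl [:: a]; have mt := measurable_cyl [:: true].
(* On this rectangle the joining has mass the density of the [k] in [S] with [x k = a], and its
   second side has mass [dens R F S]. *)
have := hdisj derived joint (measurableX ma mt).
have -> : (mu \x nu)%E (cyl [:: a] `*` cyl [:: true]) =
    (mu (cyl [:: a]) * nu (cyl [:: true]))%E by exact: product_measure1E.
rewrite hlam nu_cyl mu_cyl.
rewrite (_ : _ @^-1` _ = cyl [:: (a, true)]); last first.
  apply/seteqP; split => u; rewrite /cyl /blk /= !add0n.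
    by move=> [[ua] [ut]]; rewrite -ua -ut; case: (u 0%N).
  by move=> [->].
rewrite lam0_cyl -EFinM => -[].
have -> : visits z (cyl [:: (a, true)]) = S `&` [set k | x k = a].
  apply/seteqP; split => k; rewrite /visits /cyl /blk /= /shiftn !add0n /z /y /indic_seq.
    by move=> [-> /asboolP].
  by move=> [Sk ->]; rewrite asboolT.
have -> // : visits y (cyl [:: true]) = S.
apply/seteqP; split => k; rewrite /visits /cyl /blk /= /shiftn !add0n /y /indic_seq.
  by move=> [/asboolP].
by move=> Sk; rewrite asboolT.
Qed.

End Main.

(** * Passage to ordinary limits *)

(** If [u] is not eventually in a neighbourhood [A] of [l], the complement of its preimage meets
    every cofinite set. An ultrafilter refining [\oo] and containing that complement contradicts the
    assumption. *)
Lemma ultra_cvgn (R : realType) (u : nat -> R) (l : R) :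
  (forall F, UltraFilter F -> \oo `<=` F -> u @ F --> l) -> u @ \oo --> l.
Proof.
move=> h A lA; apply: contrapT => nA.
have PG : ProperFilter (within (~` (u @^-1` A)) \oo).
  split; last exact: within_filter.
  case=> N _ hN; apply: nA; exists N => // n /hN /= n0.
  by apply: contrapT => /n0.
have [F [FU GF]] := ultraFilterLemma PG.
have Foo : \oo `<=` F by move=> B Boo; apply: GF; apply: filterS Boo.
have FA : F (u @^-1` A) by exact: (h F FU Foo).
have FnA : F (~` (u @^-1` A)) by apply: GF; exact: withinT.
have FF : F (u @^-1` A `&` ~` (u @^-1` A)) by exact: filterI.
by have [? []] := filter_ex FF.
Qed.

(** The lower limit is the supremum of the infima over tails, so one of these infima is already
    positive and serves as [d]. *)
Lemma lower_density_gt0 (R : realType) (S : set nat) : 0 < lower_density R S ->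
  exists2 d : R, 0 < d & \forall n \near \oo, d <= freq R S n.
Proof.
have bS : bounded_fun (freq R S : R^o ^nat).
  exists 1; split; first exact: num_real.
  move=> M M1 n _; have /andP[f0 f1] := freq_itv R S n.
  by rewrite /= ger0_norm// (le_trans f1)// ltW.
rewrite /lower_density -/(freq R S) limn_infE// => /sup_gt[].
  by exists (infs (freq R S) 0%N), 0%N.
move=> _ [n _ <-] n0; exists (infs (freq R S) n) => //; exists n => // k /= nk.
apply: ge_inf; first exact/has_lbound_sdrop/bounded_fun_has_lbound.
by exists k.
Qed.

(** * Counting along the increasing enumeration of [S] *)

Section Enumeration.
Variables (S : set nat) (e : nat -> nat).
Hypothesis eS : enumerates S e.

Lemma enumerates_lt : {homo e : i j / (i < j)%N}.
Proof. by apply: homo_ltn; [exact: ltn_trans|exact: eS.1]. Qed.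

Lemma enumerates_ge n : (n <= e n)%N.
Proof. by elim: n => // n IH; apply: leq_ltn_trans IH (eS.1 n). Qed.

(** By induction on [N]: the only element of [S] from [e N] up to but excluding [e N.+1] is
    [e N]. *)
Lemma dens_count_enumerates (Q : set nat) N :
  dens_count (S `&` Q) (e N) = (\sum_(k < N) asbool (Q (e k)))%N.
Proof.
have eP k : S k -> exists j, e j = k by rewrite -eS.2 => -[j _ <-]; exists j.
have le j k : (e j < e k)%N -> (j < k)%N.
  by apply: contraTT; rewrite -!leqNgt leq_eqVlt => /orP[/eqP -> //|/enumerates_lt/ltnW].
rewrite /dens_count; elim: N => [|N IH].
  rewrite big_ord0 big1// => k _; rewrite asboolF// => -[/eP[j ejk] _].
  by have := ltn_ord k; rewrite -ejk => /le.
rewrite big_ord_recr /= -IH -!(big_mkord xpredT (fun k => nat_of_bool (asbool ((S `&` Q) k)))).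
rewrite (big_cat_nat _ (n := e N)) //=; last exact/ltnW/eS.1.
congr addn; rewrite big_ltn; last exact: eS.1.
rewrite big_nat big1 ?addn0.
  by congr nat_of_bool; apply: asbool_equiv_eq; split=> [[]|] // q; split => //; rewrite -eS.2; exists N.
move=> k /andP[Nk kN]; rewrite asboolF// => -[/eP[j ejk] _].
by move: Nk kN; rewrite -ejk => /le Nj /le; rewrite ltnS leqNgt Nj.
Qed.

End Enumeration.

Theorem mainTheorem7 (R : realType) (L : pointedType)
  (hL : countable [set: L])
  (mu : probability (seqsp L) R) (hmu : shift_invariant mu)
  (S : set nat) (hS : 0 < lower_density R S)
  (hdisj : forall nu : probability (seqsp bool) R,
             derived_from S nu -> disjoint_measures mu nu) :
  forall (x : nat -> L), normal mu x ->
  forall (a : L) (e : nat -> nat), enumerates S e ->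
    (fun N : nat => (\sum_(k < N) asbool (x (e k) = a))%:R / N%:R : R)
      @ \oo --> fine (mu (cyl [:: a])).
Proof.
move=> x mux a e eS.
have [d d0 Sd] := lower_density_gt0 hS.
set p := fine _; pose B := S `&` [set k | x k = a].
have v0 : (fun n => freq R B n - p * freq R S n) @ \oo --> (0 : R).
  apply: ultra_cvgn => F FU Foo.
  have BS : dens R F B = p * dens R F S by exact: ultra_dens_product.
  rewrite -(subrr (dens R F B)) {2}BS.
  by apply: cvgB; [exact: dens_cvg|apply: cvgMr; exact: dens_cvg].
have e_oo (A : set nat) : \oo A -> \oo [set N | A (e N)].
  by case=> M _ MA; exists M => // N /= MN; apply: MA; exact: leq_trans MN (enumerates_ge eS N).
apply/cvgrPdist_le => eps eps0.
(* The factor [d] is cancelled at the end by dividing by the frequency of [S], which is at least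
   [d]. *)
have ed0 : 0 < eps * d by rewrite mulr_gt0.
move/cvgrPdist_le : v0 => /(_ _ ed0) v0.
have := e_oo _ Sd; have := e_oo _ v0; apply: filterS2 => N /=.
rewrite sub0r normrN => vN dN.
(* For [e N = 0] the frequency would be [0] by convention, below [d]. *)
have eN0 : (e N)%:R != 0 :> R.
  by apply: contraTneq dN => eN; rewrite -ltNge /freq eN invr0 mulr0.
(* The window of length [e N] excludes [e N] itself, hence holds exactly [e 0], ..., [e (N - 1)]. *)
have SN : dens_count S (e N) = N.
  rewrite -[S in dens_count S]setIT (dens_count_enumerates eS).
  by rewrite (eq_bigr (fun=> 1%N)) ?sum1_card ?card_ord// => k _; rewrite asboolT.
have fS : freq R S (e N) = N%:R / (e N)%:R by rewrite /freq SN.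
have N0 : N%:R != 0 :> R.
  by apply: contraTneq dN => N0; rewrite -ltNge fS N0 mul0r.
have fB : freq R B (e N) = (\sum_(k < N) asbool (x (e k) = a))%:R / (e N)%:R.
  by rewrite /freq /B (dens_count_enumerates eS).
set c := (\sum_(k < N) _)%:R in fB *.
have -> : p - c / N%:R = - (freq R B (e N) - p * freq R S (e N)) / freq R S (e N).
  by rewrite fB fS; field; rewrite N0 eN0.
have fS0 : 0 < freq R S (e N) by exact: lt_le_trans dN.
rewrite normrM normrN normfV (gtr0_norm fS0) ler_pdivrMr//.
by apply: (le_trans vN); rewrite ler_pM2l.
Qed.
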